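(* Let $a_k(x)=\sum_{m=0}^k\binom{2k+2-m}{k-m}x^m$ for $k\ge 0$, and let $H_0(n,x)=\det[a_{i+j}(x)]_{0\le i,j\le n}$ for $n\ge 0$. Then $\{H_0(n,x)\}_{n\ge 0}$ is a Sturm sequence on $(-2,2)$.
   Context: A sequence of polynomials $\{P_n(x)\}_{n\ge 0}$ with $\deg P_n=n$ is called a Sturm sequence on an open interval $(a,b)$ if $P_n$ has exactly $n$ simple real zeros in $(a,b)$, and for every $n\ge 1$ the zeros of $P_n(x)$ and $P_{n+1}(x)$ strictly interlace (i.e. strictly between any two consecutive zeros of $P_{n+1}$ there is exactly one zero of $P_n$). $H_0(n,x)$ is the determinant of the $(n+1)\times(n+1)$ Hankel matrix with $(i,j)$ entry $a_{i+j}(x)$; the subscript $0$ is only a label. *)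

(* Defs.v *)
(* MathComp world; the real field is an arbitrary R : realType. *)
From HB Require Import structures.
From mathcomp Require Import all_boot all_order all_algebra.
From mathcomp Require Import reals.

Set Implicit Arguments.
Unset Strict Implicit.
Unset Printing Implicit Defensive.

Import Order.TTheory GRing.Theory Num.Theory.

Local Open Scope ring_scope.

(* mup x p is the multiplicity of x as a root of p, so mup x p = 1 means
   that x is a simple zero. *)
Definition has_simple_zeros (R : realType) (n : nat) (a b : R)
    (p : {poly R}) : Prop :=
  exists s : seq R, [/\ uniq s, size s = n &
    forall x : R, (x \in s) <-> (a < x < b /\ mup x p = 1%N)].

Definition consecutive_zeros (R : realType) (p : {poly R}) (x y : R) : Prop :=
  [/\ x < y, root p x, root p y & forall z : R, x < z < y -> ~~ root p z].

Definition strictly_interlace (R : realType) (p q : {poly R}) : Prop :=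
  forall x y : R, consecutive_zeros q x y ->
    exists! z : R, x < z < y /\ root p z.

(* size p = n.+1 is deg p = n; in particular p != 0. *)
Definition sturm_sequence (R : realType) (a b : R) (P : nat -> {poly R}) :
    Prop :=
  [/\ forall n : nat, size (P n) = n.+1,
      forall n : nat, has_simple_zeros n a b (P n) &
      forall n : nat, (1 <= n)%N -> strictly_interlace (P n) (P n.+1)].

(* The truncated subtractions are exact since m <= k. *)
Definition a_ (R : realType) (k : nat) : {poly R} :=
  \sum_(m < k.+1) ('C(2 * k + 2 - m, k - m))%:R *: 'X^m.

Definition H0 (R : realType) (n : nat) : {poly R} :=
  \det (\matrix_(i < n.+1, j < n.+1) a_ R (i + j)).

(* Main.v *)
(** With [x = 'X], the entries [a_k(x)] are moments of a linear functional [L] on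
polynomials in [w]. Put [q_0 = 1], [q_1 = w - 2 - x],
[q_2 = (w - 2) q_1 - (2 - x)] and [q_(k+1) = (w - 2) q_k - q_(k-1)]. The mixed
moments [L(w^j q_k)] vanish for [k > j + 2] and equal [1] for [k = j + 2]; two
sequences annihilate all rows of this banded array, namely
[(-1)^k ((2k-1) x + 2)] and [U_(k-2)(x/2)]. The combination of the two that
vanishes at index [n + 2] relates consecutive Hankel determinants, and
[(x + 2) H_n = (-1)^n D_n] with
[D_n = U_(n-1)(x/2) ((2n+3) x + 2) + U_n(x/2) ((2n+1) x + 2)].

At a zero [z > -2] of [D_n], Cassini's identity for Chebyshev polynomials gives
[D_(n+1) D_(n-1) = - ((z+2) U_n(z/2) ((2n+1) z + 2))^2], which is nonzero because
the monic integer polynomials [U_k(x/2)] have no zero of the form [-2/m] with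
[m > 1] odd. Together with [H_n(-2) > 0] and [(-1)^n H_n(2) > 0] this yields
interlacing zeros by induction and the intermediate value theorem. *)
Require Import Defs.
From mathcomp Require Import all_boot all_order all_algebra.
From mathcomp Require Import reals boolp.
From mathcomp Require Import ring lra zify.

Set Implicit Arguments.
Unset Strict Implicit.
Unset Printing Implicit Defensive.

Import Order.TTheory GRing.Theory Num.Theory.

Local Open Scope ring_scope.

(** * Two-step induction and a weighted Pascal triangle *)

Lemma nat_pair_ind (P : nat -> Prop) :
  P 0 -> P 1 -> (forall k, P k -> P k.+1 -> P k.+2) -> forall k, P k.
Proof.
move=> P0 P1 PSS k; suff [] : P k /\ P k.+1 by [].
by elim: k => [//|k [Pk PSk]]; split => //; apply: PSS.
Qed.

(* Pascal's triangle with boundary column [x^n] in place of [1]. *)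
Fixpoint wpascal (K : comNzRingType) (x : K) (n l : nat) : K :=
  match n, l with
  | _, 0 => x ^+ n
  | 0, _.+1 => 0
  | n'.+1, l'.+1 => wpascal x n' l' + wpascal x n' l
  end.

Section HankelEvaluation.
Variables (K : comNzRingType) (x : K).
Local Notation e := (wpascal x).

Lemma wpascal0 n : e n 0 = x ^+ n. Proof. by case: n. Qed.

Lemma wpascalS n l : e n.+1 l.+1 = e n l + e n l.+1. Proof. by []. Qed.

Lemma wpascal_small n l : (n < l)%N -> e n l = 0.
Proof.
elim: n l => [|n IHn] [|l] // ltnl.
by rewrite wpascalS !IHn ?addr0 // ltnW.
Qed.

Lemma wpascal_sum n l :
  e n.+1 l.+1 = \sum_(m < n.+1) 'C(n - m, l)%:R * x ^+ m.
Proof.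
elim: n l => [|n IHn] l.
  by rewrite big_ord1 /= addr0; case: l => [|l]; rewrite /= ?mul1r ?mul0r.
rewrite wpascalS IHn [RHS]big_ord_recr subnn; case: l => [|l].
  rewrite wpascal0 mul1r addrC; congr (_ + _).
  by apply: eq_bigr => m _; rewrite !bin0.
rewrite IHn bin0n mul0r [RHS]addr0 -big_split; apply: eq_bigr => m _ /=.
by rewrite subSn -1?ltnS // binS natrD mulrDl addrC.
Qed.

(** Column [l] has generating function [t^l / ((1-t)^l (1 - x t))], and
    [1 - (x-1) t/(1-t) = (1 - x t)/(1-t)] cancels the factor containing [x]. *)
Lemma wpascal_bin n l : e n l - (x - 1) * e n l.+1 = 'C(n, l)%:R.
Proof.
elim: n l => [|n IHn] [|l]; rewrite ?wpascalS.
- by rewrite /= mulr0 subr0.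
- by rewrite /= mulr0 subr0.
- by have := IHn 0; rewrite !wpascal0 !bin0 => <-; rewrite exprS; ring.
by rewrite binS natrD -!IHn; ring.
Qed.

(** * Moments, mixed moments and their recurrences *)

Definition hmoment (j : nat) : K := e (2 * j + 3) (j + 3).

(* Closed form of [L(w^j q_k)]; at [k = 0] the second branch would give
   [(2 - x) * hmoment j] (see [mixed_moment0]). *)
Definition mixed_moment (j k : nat) : K :=
  if k is 0 then hmoment j else
  'C(2 * j + 2, j + k)%:R + e (2 * j + 2) (j + k + 3)
    - (x - 1) * e (2 * j + 2) (j + k + 2).
Arguments mixed_moment : simpl never.
Local Notation G := mixed_moment.

Lemma hmomentE j :
  hmoment j = e (2 * j + 2) (j + 2) + e (2 * j + 2) (j + 3).
Proof. by rewrite /hmoment !addn3 !addn2 wpascalS. Qed.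

Lemma mixed_moment0 j : (2 - x) * G j 0 =
  'C(2 * j + 2, j)%:R + e (2 * j + 2) (j + 3)
    - (x - 1) * e (2 * j + 2) (j + 2).
Proof.
have ->: 'C(2 * j + 2, j) = 'C(2 * j + 2, j + 2).
  by rewrite -bin_sub; [congr 'C(_, _); lia | lia].
rewrite /mixed_moment hmomentE -wpascal_bin !addn2 !addn3; ring.
Qed.

(** This recurrence and the two for columns [1] and [k.+2] express multiplication by [w]:
    [w q_0 = q_1 + (2+x) q_0], [w q_1 = q_2 + 2 q_1 + (2-x) q_0], then
    [w q_k = q_(k+1) + 2 q_k + q_(k-1)]. Raising [j] by one moves two rows down the triangle. *)
Lemma mixed_momentS0 j : G j.+1 0 = G j 1 + (2 + x) * G j 0.
Proof.
rewrite /mixed_moment !hmomentE -wpascal_bin.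
have -> : (2 * j.+1 + 2 = (2 * j + 2).+2)%N by lia.
move: (2 * j + 2)%N => N.
rewrite !addn1 !addn2 !addn3 !wpascalS; ring.
Qed.

Lemma pascal2 (N l : nat) :
  'C(N.+2, l.+2) = ('C(N, l.+2) + 2 * 'C(N, l.+1) + 'C(N, l))%N.
Proof. by rewrite !binS; lia. Qed.

Lemma mixed_momentS1 j : G j.+1 1 = G j 2 + 2 * G j 1 + (2 - x) * G j 0.
Proof.
rewrite mixed_moment0 /mixed_moment.
have -> : (2 * j.+1 + 2 = (2 * j + 2).+2)%N by lia.
move: (2 * j + 2)%N => N.
rewrite !addn1 !addn2 !addn3 pascal2 !wpascalS !natrD; ring.
Qed.

Lemma mixed_momentSS j k :
  G j.+1 k.+2 = G j k.+3 + 2 * G j k.+2 + G j k.+1.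
Proof.
rewrite /mixed_moment.
have -> : (2 * j.+1 + 2 = (2 * j + 2).+2)%N by lia.
move: (2 * j + 2)%N => N.
rewrite !addn2 !addn3 !addnS !addSn pascal2 !wpascalS !natrD; ring.
Qed.

Lemma mixed_moment_top j : G j (j + 2) = 1.
Proof.
rewrite addn2 /mixed_moment !wpascal_small; try lia.
have -> : (j + j.+2 = 2 * j + 2)%N by lia.
by rewrite binn mulr0 subr0 addr0.
Qed.

Lemma mixed_moment_big j k : (j + 2 < k)%N -> G j k = 0.
Proof.
case: k => // k ltjk; rewrite /mixed_moment !wpascal_small; try lia.
by rewrite bin_small; [rewrite mulr0 subr0 addr0 | lia].
Qed.

(* The hypotheses say that [s] is an eigenvector of the transposed Jacobi matrix
   of multiplication by [w], orthogonal to row [0]. *)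
Lemma mixed_moment_annihil (s : nat -> K) (lam : K) :
    (forall k, s k + 2 * s k.+1 + s k.+2 = lam * s k.+1) ->
    (2 + x) * s 0 + (2 - x) * s 1 = lam * s 0 ->
    s 0 + 2 * s 1 + s 2 = 0 ->
  forall j, \sum_(k < j + 3) s k * G j k = 0.
Proof.
move=> sS s1 s0 j; rewrite -(big_mkord xpredT (fun k => s k * G j k)).
elim: j => [|j IHj].
  rewrite !big_nat_recr //= big_geq // /mixed_moment /hmoment /=.
  (* Row [0] of the mixed moments is [1, 2, 1, 0, ...]. *)
  transitivity (s 0 + 2 * s 1 + s 2); last exact: s0.
  by rewrite /binomial /= !expr0; ring.
have ext m : (m >= j + 3)%N ->
    \sum_(0 <= k < m) s k * G j k = 0.
  move=> lejm; rewrite (big_cat_nat (n := (j + 3)%N)) //= IHj add0r.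
  rewrite big_nat big1 // => k /andP[lejk _].
  by rewrite mixed_moment_big ?mulr0 //; lia.
pose T m := \sum_(0 <= k < m.+2) s k * G j.+1 k.
(* Summation by parts: inserting the recurrences and collecting the coefficient of each [G j k]
   gives [lam * s k], up to two terms at the truncation. *)
have TE m : T m = lam * (\sum_(0 <= k < m.+2) s k * G j k)
    - s m.+2 * G j m.+1 + s m.+1 * G j m.+2.
  rewrite /T; elim: m => [|m IHm].
    rewrite !big_nat_recr //= !big_geq // mixed_momentS0 mixed_momentS1.
    transitivity ((lam * s 0%N) * G j 0 + (lam * s 1%N) * G j 1 
      - s 2 * G j 1 + s 1%N * G j 2); last by ring.
    by rewrite -s1 -(sS 0%N) /=; ring.
  rewrite big_nat_recr //= IHm mixed_momentSS [in RHS]big_nat_recr //=.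
  rewrite [in RHS]mulrDr mulrA -sS; ring.
have -> : (j.+1 + 3 = j.+2.+2)%N by lia.
(* At [m = j + 2] both boundary entries of row [j] lie outside the band. *)
rewrite -/(T j.+2) TE ext; last by lia.
by rewrite !mixed_moment_big ?mulr0 ?subr0 ?addr0 //; lia.
Qed.


(** * Coefficients of the polynomials [q_k] *)

(* [opcoef k i] is the coefficient of [w^i] in [q_k]. *)
Fixpoint opcoef (k i : nat) : K :=
  match k with
  | 0 => (i == 0)%:R
  | k1.+1 => (if i is i'.+1 then opcoef k1 i' else 0) -
     match k1 with
     | 0 => (2 + x) * (i == 0)%:R
     | k2.+1 => 2 * opcoef k1 i + (if k2 is 0 then 2 - x else 1) * opcoef k2 i
     end
  end.

Lemma opcoefSS k i : opcoef k.+2 i =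
  (if i is i'.+1 then opcoef k.+1 i' else 0) -
     (2 * opcoef k.+1 i + (if k is 0 then 2 - x else 1) * opcoef k i).
Proof. by []. Qed.

Lemma opcoef_gt k i : (k < i)%N -> opcoef k i = 0.
Proof.
elim/nat_pair_ind: k i => [|| k IH1 IH2] [|i] // ltki.
  by case: i ltki => // i _; rewrite /= mulr0 subr0.
by rewrite opcoefSS IH2 // (IH2 i.+1) ?(IH1 i.+1) ?mulr0 ?addr0 ?subr0 //; lia.
Qed.

Lemma opcoef_diag k : opcoef k k = 1.
Proof.
elim/nat_pair_ind: k => [|| k IH1 IH2] //; first by rewrite /= mulr0 subr0.
by rewrite opcoefSS IH2 !opcoef_gt ?mulr0 ?addr0 ?subr0 //.
Qed.

(** Pairing with any sequence [a] turns multiplication by [w] into the shift [j -> j.+1]. *)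
Lemma opcoef_sum (a : nat -> K) n k j :
  \sum_(i < n.+1) opcoef k.+2 i * a (j + i)%N =
  \sum_(i < n) opcoef k.+1 i * a (j.+1 + i)%N
  - (2 * \sum_(i < n.+1) opcoef k.+1 i * a (j + i)%N
  + (if k is 0 then 2 - x else 1) * \sum_(i < n.+1) opcoef k i * a (j + i)%N).
Proof.
under eq_bigr do rewrite opcoefSS mulrBl mulrDl -!mulrA.
rewrite sumrB big_split /= -!mulr_sumr big_ord_recl mul0r add0r.
by congr (_ - _); apply: eq_bigr => i _; rewrite /= /bump /= addnS addSn.
Qed.

(** Both sides obey the same three-term recurrence in [k]. The bound [n] is left free because the
    induction step mixes sums of lengths [n] and [n.+1]. *)
Lemma mixed_momentE n k j : (k < n)%N ->
  \sum_(i < n) opcoef k i * hmoment (j + i) = G j k.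
Proof.
elim/nat_pair_ind: k n j => [|| k IH1 IH2] [|n] j // ltkn.
- rewrite big_ord_recl /= mul1r addn0 big1 ?addr0 // => i _.
  by rewrite mul0r.
- case: n ltkn => // n _.
  rewrite !big_ord_recl big1 => [|i _]; last by rewrite /= mulr0 subr0 mul0r.
  rewrite /= addn0 /bump addn1 -/(G j 0) -/(G j.+1 0) mixed_momentS0; ring.
rewrite (opcoef_sum hmoment).
have -> := IH2 n j.+1 ltkn.
have -> := IH2 n.+1 j (ltnW ltkn).
have -> := IH1 n.+1 j (ltnW (ltnW ltkn)).
case: k {IH1 IH2 ltkn} => [|k].
  by rewrite mixed_momentS1; ring.
by rewrite mixed_momentSS; ring.
Qed.

(** * Hankel determinants through mixed moments, and a Cramer-type identity *)

Definition hankel_det n := \det (\matrix_(i < n, j < n) hmoment (i + j)).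

(** Passing from the powers of [w] to the monic [q_k] on one side multiplies by a unitriangular
    matrix. *)
Lemma hankel_det_mixed n : hankel_det n = \det (\matrix_(j < n, k < n) G j k).
Proof.
pose C : 'M[K]_n := \matrix_(k, i) opcoef k i.
have <- : (\matrix_(i < n, j < n) hmoment (i + j)) *m C^T =
          \matrix_(j < n, k < n) G j k.
  apply/matrixP => j k; rewrite !mxE -(mixed_momentE j (ltn_ord k)).
  by apply: eq_bigr => i _; rewrite !mxE mulrC.
rewrite det_mulmx det_tr (det_trig (A := C)).
  by rewrite big1 ?mulr1 // => i _; rewrite mxE opcoef_diag.
by apply/is_trig_mxP => i j ltij; rewrite mxE opcoef_gt.
Qed.

(** As in Cramer's rule, [M] is multiplied by the identity with last column replaced by [v]; the
    product has last column [c] times the last unit vector, and is expanded along it. *)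
Lemma det_last_col n (M : 'M[K]_n.+1) (v : 'I_n.+1 -> K) (c : K) :
    (forall i, \sum_k M i k * v k = c *+ (i == ord_max)) ->
  \det M * v ord_max = c * \det (\matrix_(i < n, j < n)
     M (widen_ord (leqnSn n) i) (widen_ord (leqnSn n) j)).
Proof.
move=> Mv.
pose V : 'M[K]_n.+1 := \matrix_(i, j) if j == ord_max then v i else (i == j)%:R.
have <- : \det V = v ord_max.
  rewrite -det_tr det_trig; last first.
    apply/is_trig_mxP => i j ltij; rewrite !mxE ifF.
      by rewrite -val_eqE /= gtn_eqF.
    by apply/eqP => ij; move: ltij (ltn_ord j); rewrite ij /=; lia.
  rewrite (bigD1 ord_max) //= big1 ?mulr1.
    by rewrite !mxE eqxx.
  by move=> i /negPf ni; rewrite !mxE ni eqxx.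
rewrite -det_mulmx (expand_det_col _ ord_max) (bigD1 ord_max) //= big1.
  rewrite addr0 !mxE.
  under eq_bigr do rewrite mxE eqxx.
  rewrite Mv eqxx mulr1n; congr (_ * _).
  rewrite /cofactor addnn -signr_odd odd_double mul1r; congr (\det _).
  have lw (i : 'I_n) : lift ord_max i = widen_ord (leqnSn n) i.
    by apply: val_inj; exact: lift_max.
  have nlw (j : 'I_n) : (widen_ord (leqnSn n) j == ord_max) = false.
    by rewrite -lw eq_sym (negPf (neq_lift _ _)).
  apply/matrixP => i j; rewrite !mxE lw (bigD1 (widen_ord (leqnSn n) j)) //=.
  rewrite mxE lw nlw eqxx mulr1 big1 ?addr0 // => k /negPf nk.
  by rewrite mxE nlw nk mulr0.
move=> i /negPf ni; rewrite mxE.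
under eq_bigr do rewrite mxE eqxx.
by rewrite Mv ni mulr0n mul0r.
Qed.


(** * Chebyshev polynomials and the recursion between consecutive determinants *)

(* [cheb n] is U_{n-1}(x/2). *)
Fixpoint cheb (n : nat) : K :=
  match n with
  | 0 => 0
  | n1.+1 => if n1 is n2.+1 then x * cheb n1 - cheb n2 else 1
  end.

Lemma chebSS n : cheb n.+2 = x * cheb n.+1 - cheb n. Proof. by []. Qed.

(** The quadratic form [a^2 - x a b + b^2] is invariant under [(a, b) -> (x a - b, a)]. In
    particular consecutive values have no common zero. *)
Lemma cheb_cassini n :
  cheb n.+1 ^+ 2 - x * cheb n.+1 * cheb n + cheb n ^+ 2 = 1.
Proof.
elim: n => [|n IHn]; first by rewrite /=; ring.
by rewrite -[RHS]IHn chebSS; ring.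
Qed.

(* This is [D_n]. *)
Definition sturm_num (n : nat) : K :=
  cheb n * ((2 * n + 3)%:R * x + 2) + cheb n.+1 * ((2 * n + 1)%:R * x + 2).

(** For eigenvalue [0] the recurrence has solutions [(-1)^k] times a linear function of [k]; the
    boundary equation fixes that function up to scale. *)
Let s1 k : K := (-1) ^+ k * (((2 * k)%:R - 1) * x + 2).
(** Eigenvalue [x + 2] gives the Chebyshev recurrence; the value [-1] at index [0] is its backward
    extension [U_(-2)]. *)
Let s2 k : K := if k is k'.+1 then cheb k' else -1.

Lemma s1_annihil j : \sum_(k < j + 3) s1 k * G j k = 0.
Proof.
apply: (mixed_moment_annihil (lam := 0)) => [k||]; rewrite /s1.
- by rewrite !exprS !natrM -![in LHS]natr1; ring.
- by rewrite !exprS; ring.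
- by rewrite !exprS; ring.
Qed.

Lemma s2_annihil j : \sum_(k < j + 3) s2 k * G j k = 0.
Proof.
apply: (mixed_moment_annihil (lam := x + 2)) => [[|k]||] /=; ring.
Qed.

Lemma hankel_det_rec n :
  hankel_det n.+2 * sturm_num n = - sturm_num n.+1 * hankel_det n.+1.
Proof.
(* The combination is chosen to vanish at [n.+2]; the sign makes its values at the two neighbouring
   indices exactly [D_n] and [D_(n+1)]. *)
pose v k := (-1) ^+ n * (s2 k * s1 n.+2 - s1 k * s2 n.+2).
have v_annihil j : \sum_(k < j + 3) v k * G j k = 0.
  transitivity ((-1) ^+ n * (s1 n.+2 * (\sum_(k < j + 3) s2 k * G j k)
      - s2 n.+2 * (\sum_(k < j + 3) s1 k * G j k))).
    rewrite !mulr_sumr -sumrB mulr_sumr; apply: eq_bigr => k _.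
    by rewrite /v; ring.
  by rewrite s1_annihil s2_annihil !mulr0 subr0 mulr0.
have sgn2 : (-1) ^+ n * (-1) ^+ n = 1 :> K by rewrite -expr2 sqrr_sign.
have v0 : v n.+2 = 0 by rewrite /v; ring.
have v1 : v n.+1 = sturm_num n.
  rewrite -[RHS]mul1r -[X in _ = X * _]sgn2 /v /s1 /s2 /sturm_num !exprS.
  rewrite !natrD !natrM -!natr1.
  ring.
have v3 : v n.+3 = sturm_num n.+1.
  rewrite -[RHS]mul1r -[X in _ = X * _]sgn2 /v /s1 /s2 /sturm_num !exprS.
  rewrite !natrD !natrM -!natr1.
  ring.
rewrite !hankel_det_mixed -v1 -v3.
have /= -> := @det_last_col _ _ (fun k => v (val k)) (- v n.+3).
  by congr (_ * \det _); apply/matrixP => i j; rewrite !mxE.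
move=> i; under eq_bigr do rewrite mxE mulrC.
rewrite -(big_mkord xpredT (fun k => v k * G i k)).
have := v_annihil i; rewrite -(big_mkord xpredT (fun k => v k * G i k)).
(* Rows before the last end by column [n.+2], where [v] vanishes, so truncation costs nothing. The
   last row also loses its entry [1] in column [n.+3], which leaves [- v n.+3]. *)
have := ltn_ord i; rewrite ltnS leq_eqVlt orbC => /orP[lt_in|/eqP eq_in] E.
  rewrite -val_eqE /= ltn_eqF // mulr0n.
  have : \sum_(0 <= k < n.+3) v k * G i k = 0.
    rewrite (big_cat_nat (n := (i + 3)%N)) //=; last by lia.
    rewrite E add0r big_nat big1 // => k /andP[le_k _].
    by rewrite mixed_moment_big ?mulr0 //; lia.
  by rewrite big_nat_recr //= v0 mul0r addr0.
have -> : i = ord_max by apply: val_inj.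
rewrite eqxx mulr1n /=; move: E; rewrite eq_in.
have -> : (n.+1 + 3 = n.+4)%N by lia.
rewrite (big_nat_recr n.+3) // (big_nat_recr n.+2) //= v0 mul0r addr0.
have -> : n.+3 = (n.+1 + 2)%N by lia.
by rewrite mixed_moment_top mulr1 => /eqP; rewrite addr_eq0 => /eqP.
Qed.

End HankelEvaluation.

(** * Closed form of the determinants and identification of the entries *)

Lemma hankel_det_sturm (K : idomainType) (x : K) :
    (forall n, sturm_num x n != 0) ->
  forall n, (x + 2) * hankel_det x n.+1 = (-1) ^+ n * sturm_num x n.
Proof.
move=> num0; elim=> [|n IHn].
  by rewrite /hankel_det det_mx11 mxE /sturm_num /hmoment /= !expr0; ring.
apply: (mulIf (num0 n)).
rewrite -mulrA hankel_det_rec mulrCA IHn exprS; ring.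
Qed.

(** Binomial symmetry matches the terms with [m <= k]; the later ones vanish because
    [2k + 2 - m < k + 2]. *)
Lemma a_E (R : realType) k : a_ R k = hmoment 'X k.
Proof.
rewrite /a_ /hmoment !addn3 wpascal_sum.
rewrite -(big_mkord xpredT (fun m => 'C(2 * k + 2 - m, k - m)%:R *: 'X^m)).
rewrite -(big_mkord xpredT (fun m => 'C((2 * k).+2 - m, k.+2)%:R * 'X^m)).
rewrite [RHS](big_cat_nat (n := k.+1)) //=; last by lia.
rewrite [X in _ + X]big_nat [X in _ + X]big1 ?addr0 => [|m /andP[lekm _]].
  rewrite big_nat [RHS]big_nat; apply: eq_bigr => m /andP[_ ltmk].
  rewrite scaler_nat mulr_natl; congr (_ *+ _).
  by rewrite -bin_sub; [congr 'C(_, _); lia | lia].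
by rewrite bin_small ?mul0r //; lia.
Qed.

Lemma H0E (R : realType) n : H0 R n = hankel_det 'X n.+1.
Proof.
by congr (\det _); apply/matrixP => i j; rewrite !mxE a_E.
Qed.

(** * Degrees and endpoint values *)

Section ChebyshevValues.
Variable R : realType.
Implicit Types (z : R) (n : nat).

Lemma natr_lin (n a : nat) : (2 * n + a)%:R = 2 * n%:R + a%:R :> R.
Proof. by rewrite natrD natrM. Qed.

Lemma horner_cheb z n : (cheb ('X : {poly R}) n).[z] = cheb z n.
Proof.
elim/nat_pair_ind: n => [|| n IH1 IH2]; rewrite ?hornerC //.
by rewrite !chebSS hornerD hornerN hornerM hornerX IH1 IH2.
Qed.

Lemma horner_sturm_num z n : (sturm_num ('X : {poly R}) n).[z] = sturm_num z n.
Proof.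
by rewrite /sturm_num -!polyC_natr !(hornerE, horner_cheb).
Qed.

Lemma size_cheb n : (size (cheb ('X : {poly R}) n) <= n)%N.
Proof.
elim/nat_pair_ind: n => [|| n IH1 IH2]; rewrite ?size_poly0 ?size_poly1 //.
rewrite chebSS (leq_trans (size_polyD _ _)) // geq_max size_polyN.
apply/andP; split; last by rewrite (leq_trans IH1) // leqW.
by rewrite (leq_trans (size_polyMleq _ _)) // size_polyX.
Qed.

Lemma size_sturm_num n : (size (sturm_num ('X : {poly R}) n) <= n.+2)%N.
Proof.
have lin k (p : {poly R}) : (size p <= n.+1)%N ->
    (size (p * (k%:R * 'X + 2))%R <= n.+2)%N.
  move=> lepn; rewrite (leq_trans (size_polyMleq _ _)) //.
  have : (size (k%:R * 'X + 2 : {poly R})%R <= 2)%N.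
    rewrite -!polyC_natr mul_polyC.
    rewrite (leq_trans (size_polyD _ _)) // geq_max size_polyC.
    rewrite (leq_trans (size_scale_leq _ _)) ?size_polyX //=; by case: eqP.
  by lia.
rewrite (leq_trans (size_polyD _ _)) // geq_max !lin //.
  exact: size_cheb.
exact: leq_trans (size_cheb _) _.
Qed.

Lemma cheb_2 n : cheb (2 : R) n = n%:R.
Proof.
elim/nat_pair_ind: n => [|| n IH1 IH2] //.
by rewrite chebSS IH1 IH2 -!natr1; ring.
Qed.

Lemma cheb_N2 n : cheb (- 2 : R) n = - (-1) ^+ n * n%:R.
Proof.
elim/nat_pair_ind: n => [|| n IH1 IH2].
- by rewrite mulr0.
- by rewrite /= expr1; ring.
by rewrite chebSS IH1 IH2 -!natr1 !exprS; ring.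
Qed.

(** Since [x + 2] divides [D_n], the value [H_n(-2)] is read off [D_n'(-2)], which involves this
    derivative. It equals [(-1)^n] times the binomial ['C(n+1, 3)], whence the factor [6]. *)
Lemma deriv_cheb_N2 n : 6 * (cheb ('X : {poly R}) n)^`().[- 2]
  = (-1) ^+ n * ((n%:R - 1) * n%:R * (n%:R + 1)).
Proof.
elim/nat_pair_ind: n => [|| n IH1 IH2].
- by rewrite /= deriv0 horner0; ring.
- by rewrite /= -polyC1 derivC horner0; ring.
rewrite chebSS derivB derivM derivX hornerD hornerN hornerD !hornerM hornerX.
rewrite hornerC horner_cheb cheb_N2.
have n1 : n.+1%:R = n%:R + 1 :> R by rewrite natr1.
have n2 : n.+2%:R = n%:R + 2 :> R by rewrite -natrD addn2.
transitivity (- 6 * (-1) ^+ n.+1 * n.+1%:R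
    - 2 * (6 * (cheb ('X : {poly R}) n.+1)^`().[- 2])
    - 6 * (cheb ('X : {poly R}) n)^`().[- 2]); first by ring.
by rewrite IH1 IH2 n1 n2 !exprS; ring.
Qed.

(** Used twice: it shows that [D_n] is a nonzero polynomial, and it gives the sign of [H_n(2)]. *)
Lemma sturm_num_2_gt0 n : 0 < sturm_num (2 : R) n.
Proof.
rewrite /sturm_num !cheb_2 !natr_lin -(natr1 n).
have : (0 : R) <= n%:R by []. 
move: (n%:R : R) => m m0; nra.
Qed.

Lemma sturm_num_neq0 n : sturm_num ('X : {poly R}) n != 0.
Proof.
apply: contraTneq (sturm_num_2_gt0 n) => num0.
by rewrite -horner_sturm_num num0 horner0 ltxx.
Qed.

Lemma H0_sturm n : ('X + 2) * H0 R n = (-1) ^+ n * sturm_num 'X n.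
Proof. by rewrite H0E hankel_det_sturm //; apply: sturm_num_neq0. Qed.

Lemma horner_H0 z n : (z + 2) * (H0 R n).[z] = (-1) ^+ n * sturm_num z n.
Proof.
have := congr1 (horner^~ z) (H0_sturm n).
rewrite !hornerM horner_sturm_num hornerD hornerX -!polyC_natr hornerC => ->.
by rewrite -[-1]polyCN -polyC_exp hornerC.
Qed.

(** Dividing [D_n] by the monic ['X + 2] lowers the degree by one. Equality follows later from the
    existence of [n] zeros. *)
Lemma size_H0_leq n : (size (H0 R n) <= n.+1)%N.
Proof.
have := congr1 (fun p : {poly R} => size p) (H0_sturm n).
have -> : 'X + 2 = 'X - (- 2)%:P :> {poly R}.
  by rewrite polyCN opprK polyC_natr.
case: (eqVneq (H0 R n) 0) => [-> _|H0_neq0]; first by rewrite size_poly0.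
rewrite mulrC size_Mmonic ?monicXsubC // size_XsubC -signr_odd mulr_sign.
have : (size (if odd n then - sturm_num ('X : {poly R}) n
              else sturm_num 'X n) <= n.+2)%N.
  by case: odd; rewrite ?size_polyN size_sturm_num.
by move=> + sizeE; rewrite -sizeE; lia.
Qed.

Lemma H0_2 n : 0 < (-1) ^+ n * (H0 R n).[2].
Proof.
have := horner_H0 2 n; have := sturm_num_2_gt0 n.
have : (-1) ^+ n * (-1) ^+ n = 1 :> R by rewrite -expr2 sqrr_sign.
move: ((-1) ^+ n) => s ss D0 E.
have : 4 * (s * (H0 R n).[2]) = sturm_num 2 n.
  by rewrite -[RHS]mul1r -[X in _ = X * _]ss -[RHS]mulrA -E; ring.
lra.
Qed.

Lemma deriv_sturm_num_N2 n :
  3 * (sturm_num ('X : {poly R}) n)^`().[- 2]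
  = (-1) ^+ n * (2 * n%:R * (n%:R + 1) * (2 * n%:R + 1) + 3).
Proof.
have lin k : (k%:R * 'X + 2 : {poly R})^`().[- 2] = k%:R.
  by rewrite -!polyC_natr derivD derivC addr0 deriv_mulC derivX mulr1 hornerC.
have lin2 k : (k%:R * 'X + 2 : {poly R}).[- 2] = 2 - 2 * k%:R.
  by rewrite -!polyC_natr hornerD hornerM hornerX !hornerC; ring.
rewrite /sturm_num derivD !derivM !(lin, lin2, horner_cheb, hornerD, hornerM).
have := deriv_cheb_N2 n; have := deriv_cheb_N2 n.+1.
rewrite !cheb_N2 !natr_lin !exprS -(natr1 n).
move: (_^`().[_]) (_^`().[_]) (n%:R : R) ((-1) ^+ n) => d1 d0 m s E1 E0.
transitivity (6 * d1 * (1 - (2 * m + 3)) + 6 * d0 * (1 - (2 * m + 1))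
  + 3 * s * ((m + 1) * (2 * m + 1) - m * (2 * m + 3))); first by ring.
by rewrite E0 E1; ring.
Qed.

(** Differentiating [(x + 2) H_n = (-1)^n D_n] at [-2] leaves only [H_n(-2)] on the left. *)
Lemma H0_N2 n : 0 < (H0 R n).[- 2].
Proof.
have /(congr1 (fun p : {poly R} => p^`().[- 2])) := H0_sturm n.
have -> : 'X + 2 = 'X - (- 2)%:P :> {poly R}.
  by rewrite polyCN opprK polyC_natr.
have -> : (-1) ^+ n = ((-1) ^+ n)%:P :> {poly R}.
  by rewrite polyC_exp polyCN.
rewrite derivM derivXsubC mul1r mul_polyC derivZ hornerZ hornerD hornerM.
rewrite hornerXsubC subrr mul0r addr0 => H.
suff : 0 < 3 * (H0 R n).[- 2] by rewrite pmulr_rgt0 // ltr0n.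
rewrite H mulrCA deriv_sturm_num_N2 mulrA -expr2 sqrr_sign mul1r.
have : (0 : R) <= n%:R by [].
by move: (n%:R : R) => m m0; nra.
Qed.

(** * Opposite signs of the neighbours at a zero *)

(** With [z = -2/m], the number [m^n U_n(z/2)] is an integer congruent to [(-2)^n] modulo [m]; if it
    were zero, the odd [m] would divide [2^n]. *)
Lemma cheb_rational_neq0 (m : nat) z n : odd m -> (1 < m)%N ->
  m%:R * z + 2 = 0 -> cheb z n.+1 != 0.
Proof.
move=> odd_m m_gt1 mz.
have mzE : m%:R * z = - 2 by apply/eqP; rewrite -addr_eq0 mz.
have [w wE] : exists w : int,
    m%:R ^+ n * cheb z n.+1 = ((- 2) ^+ n + m%:Z * w)%:~R.
  elim/nat_pair_ind: n => [|| n [w1 IH1] [w2 IH2]].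
  - by exists 0; rewrite /= mulr0 addr0 mulr1.
  - by exists 0; rewrite chebSS /= mulr0 addr0 mulr1 subr0 !expr1 mzE intrN.
  exists (- 2 * w2 - m%:Z * ((- 2) ^+ n + m%:Z * w1)).
  rewrite chebSS mulrBr [_ ^+ _ * (z * _)](_ : _ =
      (m%:R * z) * (m%:R ^+ n.+1 * cheb z n.+2)); last by rewrite exprS; ring.
  rewrite IH2 mzE.
  rewrite [_ * cheb z n.+1](_ : _ = m%:R ^+ 2 * (m%:R ^+ n * cheb z n.+1)).
    rewrite IH1; rewrite !exprS !(rmorphD, rmorphM, rmorphN, rmorphB) /=; ring.
  by rewrite !exprS; ring.
apply/eqP => c0; move: wE; rewrite c0 mulr0 => /esym/eqP.
rewrite intr_eq0 addr_eq0 => /eqP E.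
have : (m %| 2 ^ n)%N.
  have := congr1 absz E; rewrite abszX !abszN abszM => -> .
  by rewrite dvdn_mulr.
move=> dvd_m; have : coprime m (2 ^ n) by rewrite coprimeXr // coprimen2.
rewrite /coprime (gcdn_idPl dvd_m) => /eqP m1.
by rewrite m1 in m_gt1.
Qed.

Lemma sturm_num_neighbours z n : -2 < z -> sturm_num z n.+1 = 0 ->
  sturm_num z n.+2 * sturm_num z n < 0.
Proof.
move=> z_gtN2 num0.
pose r := cheb z n.+2; pose s := cheb z n.+1.
pose al : R := (2 * n + 5)%:R * z + 2; pose be : R := (2 * n + 3)%:R * z + 2.
have sar : s * al + r * be = 0.
  rewrite -num0 /sturm_num /al /be.
  by congr (_ * (_%:R * _ + _) + _ * (_%:R * _ + _)); lia.
(* Adding the null sum [sar] after one Chebyshev step makes [D_(n+2)] factor; [D_n] is treated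
   likewise. *)
have E2 : sturm_num z n.+2 = r * (z + 2) * al.
  rewrite -[LHS]addr0 -sar /sturm_num /al /be /r /s (chebSS z n.+1).
  by rewrite !natr_lin -?(natr1 n.+1) -?(natr1 n); ring.
have E0 : sturm_num z n = s * (z + 2) * be.
  rewrite -[LHS]addr0 -sar /sturm_num /al /be /r /s (chebSS z n).
  by rewrite !natr_lin -?(natr1 n.+1) -?(natr1 n); ring.
have -> : sturm_num z n.+2 * sturm_num z n = - ((z + 2) * (r * be)) ^+ 2.
  have sa : s * al = - (r * be) by apply/eqP; rewrite -addr_eq0 sar.
  transitivity ((z + 2) ^+ 2 * (s * al) * (r * be)).
    by rewrite E2 E0; ring.
  by rewrite sa; ring.
rewrite oppr_lt0 exprn_even_gt0 //= mulf_neq0 //.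
  by rewrite gt_eqF //; lra.
(* If [r * be = 0] then [s * al = 0] too. Cassini excludes [r = s = 0], the rational-root argument
   excludes [s = be = 0] and [r = al = 0], and [al = be = 0] would force [z = 0], where [be = 2]. *)
apply/negP => /eqP rb0; have /eqP : s * al = 0 by rewrite -[LHS]addr0 -{1}rb0.
have al_nz : al = 0 -> r != 0 by apply: cheb_rational_neq0; lia.
have be_nz : be = 0 -> s != 0 by apply: cheb_rational_neq0; lia.
rewrite mulf_eq0 => /orP[/eqP s0|/eqP al0].
  move/eqP: rb0; rewrite mulf_eq0 => /orP[/eqP r0|/eqP /be_nz /eqP //].
  have := cheb_cassini z n.+1; rewrite -/r -/s r0 s0; lra.
have /eqP r_nz := al_nz al0.
move/eqP: rb0; rewrite mulf_eq0 => /orP[/eqP //|/eqP be0].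
have : al - be = 2 * z by rewrite /al /be !natr_lin; ring.
rewrite al0 be0 => z0; move: be0; rewrite /be (_ : z = 0) ?mulr0; lra.
Qed.

Lemma H0_neighbours z n : -2 < z -> root (H0 R n.+1) z ->
  (H0 R n.+2).[z] * (H0 R n).[z] < 0.
Proof.
move=> z_gtN2 /rootP Hz.
have := horner_H0 z n.+1; rewrite Hz mulr0 => /esym/eqP.
rewrite mulf_eq0 signr_eq0 /= => /eqP /(sturm_num_neighbours z_gtN2).
have := horner_H0 z n.+2; have := horner_H0 z n.
have : (-1) ^+ n * (-1) ^+ n = 1 :> R by rewrite -expr2 sqrr_sign.
rewrite !exprS; move: ((-1) ^+ n) => s ss E0 E2 lt0.
have z2 : 0 < (z + 2) ^+ 2 by apply: exprn_gt0; lra.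
rewrite -(pmulr_rlt0 _ z2).
apply: le_lt_trans lt0; rewrite le_eqVlt; apply/orP; left; apply/eqP.
transitivity (((z + 2) * (H0 R n.+2).[z]) * ((z + 2) * (H0 R n).[z])).
  by ring.
rewrite E0 E2 -[RHS]mul1r -[X in _ = X * _]ss; ring.
Qed.

End ChebyshevValues.

(** * Ordered zeros and signs of real polynomials *)

Section SturmFromAlternation.
Variable R : realType.
Implicit Types (p : {poly R}) (z : nat -> R).

(** The zeros are listed by a function on [nat], of which only the values below [n] matter. *)
Definition zeros_between (a b : R) (n : nat) p z : Prop :=
  [/\ forall i, (i < n)%N -> a < z i < b /\ root p (z i) &
      forall i j, (i < j < n)%N -> z i < z j].

Lemma ivt_neg p (c d : R) : c < d -> p.[c] * p.[d] < 0 ->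
  exists y, c < y < d /\ root p y.
Proof.
move=> ltcd.
wlog pc : p / p.[c] < 0 => [hw|] pcd.
  case: (ltgtP p.[c] 0) (pcd) => [pc|pc|->]; last by rewrite mul0r ltxx.
    by move=> _; apply: hw pcd.
  move=> _; have [||y [cyd py]]
    := hw (- p); rewrite ?hornerN ?oppr_lt0 ?mulrNN //.
  by exists y; split; rewrite // -rootN.
have pd : 0 < p.[d] by rewrite -(nmulr_rlt0 _ pc).
have [|y /andP[ley ged] py] := poly_ivt (p := p) (ltW ltcd).
  by rewrite !ltW.
exists y; split=> //; rewrite !lt_neqAle ley ged !andbT.
apply/andP; split; apply/eqP => ye; move/rootP: py.
  by rewrite -ye => /eqP; rewrite lt_eqF.
by rewrite ye => /eqP; rewrite gt_eqF.
Qed.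

Lemma zeros_between_uniq a b n p z : zeros_between a b n p z ->
  uniq (mkseq z n).
Proof.
move=> [_ z_incr]; rewrite map_inj_in_uniq ?iota_uniq // => i j.
rewrite !mem_iota !add0n /= => ltin ltjn zij.
case: (ltngtP i j) => // ltij.
  by have := z_incr i j; rewrite ltij ltjn zij ltxx => /(_ isT).
by have := z_incr j i; rewrite ltij ltin zij ltxx => /(_ isT).
Qed.

Lemma zeros_between_prod a b n p z :
    zeros_between a b n p z -> p != 0 -> (size p <= n.+1)%N ->
  size p = n.+1 /\ p = lead_coef p *: \prod_(0 <= i < n) ('X - (z i)%:P).
Proof.
move=> zP p_neq0 le_pn; have z_uniq := zeros_between_uniq zP.
case: zP => z_root _.
have z_all : all (root p) (mkseq z n).
  by apply/allP => _ /mapP[i + ->]; rewrite mem_iota => /z_root[].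
have size_p : size p = n.+1.
  apply/eqP; rewrite eqn_leq le_pn /=.
  by have := max_poly_roots p_neq0 z_all z_uniq; rewrite size_mkseq.
split=> //.
rewrite [LHS](@all_roots_prod_XsubC _ p (mkseq z n)) ?size_mkseq ?uniq_rootsE //.
by rewrite big_map /index_iota subn0.
Qed.

Lemma zeros_between_root a b n p z x :
    zeros_between a b n p z -> p != 0 -> (size p <= n.+1)%N -> root p x ->
  exists2 i, (i < n)%N & x = z i.
Proof.
move=> zP p_neq0 le_pn; have [_ ->] := zeros_between_prod zP p_neq0 le_pn.
rewrite rootZ ?lead_coef_eq0 // -(big_map z xpredT (fun c => 'X - c%:P)).
rewrite root_prod_XsubC => /mapP[i + ->]; rewrite mem_index_iota => ltin.
by exists i.
Qed.

(** In the factored product [p(t) p(a)], each [a - z k] is negative, so exactly the [i] zeros below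
    [t] contribute a negative factor. *)
Lemma zeros_between_sign a b n p z i t :
    zeros_between a b n p z -> (size p <= n.+1)%N -> 0 < p.[a] ->
    (i <= n)%N -> (forall k, (k < i)%N -> z k < t) ->
    (forall k, (i <= k < n)%N -> t < z k) ->
  0 < (-1) ^+ i * p.[t].
Proof.
move=> zP le_pn pa le_in lt_zt lt_tz.
have p_neq0 : p != 0 by apply: contraTneq pa => ->; rewrite horner0 ltxx.
have [_ pE] := zeros_between_prod zP p_neq0 le_pn.
case: zP => z_root _.
have az k : (k < n)%N -> a < z k by case/z_root => /andP[].
rewrite -(pmulr_lgt0 _ pa) pE !hornerZ !horner_prod.
set c := lead_coef p.
rewrite (_ : _ * _ * _ = c ^+ 2 * ((-1) ^+ i *
    \prod_(0 <= k < n) ((t - z k) * (a - z k)))); last first.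
  rewrite big_split /=; under eq_bigr do rewrite hornerXsubC.
  by under [X in _ * _ * (_ * X)]eq_bigr do rewrite hornerXsubC; ring.
rewrite mulr_gt0 ?exprn_even_gt0 ?lead_coef_eq0 //.
rewrite (big_cat_nat (n := i)) //= mulrA mulr_gt0 //.
  rewrite -[i in _ ^+ i]subn0 -prodr_const_nat -big_split big_nat /=.
  apply: prodr_gt0 => k ltki; rewrite mulN1r -mulrN opprB.
  by rewrite mulr_gt0 ?subr_gt0 ?lt_zt // az // (leq_trans ltki).
rewrite big_nat; apply: prodr_gt0 => k /andP[leik ltkn].
by rewrite -mulrNN !opprB mulr_gt0 ?subr_gt0 ?az ?lt_tz ?leik.
Qed.

(** * Interlacing by sign alternation *)

Variables (a b : R) (P : nat -> {poly R}).
Hypothesis ltab : a < b.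
Hypothesis size_P : forall n, (size (P n) <= n.+1)%N.
Hypothesis P_a : forall n, 0 < (P n).[a].
Hypothesis P_b : forall n, 0 < (-1) ^+ n * (P n).[b].
Hypothesis P_neighbours : forall n (z : R), a < z < b -> root (P n.+1) z ->
  (P n.+2).[z] * (P n).[z] < 0.

Let P_neq0 n : P n != 0.
Proof. by apply: contraTneq (P_a n) => ->; rewrite horner0 ltxx. Qed.

Lemma interlacing_zeros n : exists w z,
  [/\ zeros_between a b n (P n) w, zeros_between a b n.+1 (P n.+1) z &
      forall i, (i < n)%N -> z i < w i < z i.+1].
Proof.
elim: n => [|n [w [z [wP zP wz]]]].
  have [|y [ayb rooty]] := ivt_neg (p := P 1) ltab.
    by have := P_a 1; have := P_b 1; rewrite expr1; nra.
  by exists (fun=> a), (fun=> y); split=> //; split=> // i j; lia.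
have [z_root z_incr] := zP; have [w_root w_incr] := wP.
have z_le i j : (i <= j <= n)%N -> z i <= z j.
  case: (ltngtP i j) => // [ltij|->] ltjn; last exact: lexx.
  by apply/ltW/z_incr; rewrite ltij.
(* By interlacing, exactly [i] zeros of [P n] lie below [z i], which gives its sign there; [P n.+2]
   has the opposite sign. *)
have sign_z i : (i <= n)%N -> (-1) ^+ i * (P n.+2).[z i] < 0.
  move=> le_in.
  have [azb rz] := z_root i le_in.
  have neg := P_neighbours azb rz.
  have : 0 < (-1) ^+ i * (P n).[z i].
    apply: (zeros_between_sign wP) => // k.
      move=> ltki; have /andP[_] := wz k (leq_trans ltki le_in).
      by move/lt_le_trans; apply; apply: z_le; rewrite ltki.
    move=> /andP[leik ltkn]; have /andP[+ _] := wz k ltkn.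
    by apply: le_lt_trans; apply: z_le; rewrite leik ltnW.
  have : (-1) ^+ i * (-1) ^+ i = 1 :> R by rewrite -expr2 sqrr_sign.
  by move: ((-1) ^+ i) => s; nra.
(* The points [a < z 0 < ... < z n < b] bound [n + 2] gaps, numbered from [0] to [n.+1]; [P n.+2]
   changes sign across each. *)
pose lo i := if i is i'.+1 then z i' else a.
pose hi i := if i == n.+1 then b else z i.
(* The bound on [i] stands inside the existential so that choice yields a function on all of
   [nat]. *)
have ylohi i : exists y, (i <= n.+1)%N ->
    lo i < y < hi i /\ root (P n.+2) y.
  case: (leqP i n.+1) => [le_in|]; last by exists 0.
  have lo_sign : 0 < (-1) ^+ i * (P n.+2).[lo i].
    case: i le_in => [|i] le_in; first by rewrite mul1r P_a.
    by rewrite exprS mulN1r mulNr oppr_gt0 sign_z.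
  have hi_sign : (-1) ^+ i * (P n.+2).[hi i] < 0.
    rewrite /hi; case: eqP => [->|/eqP ne]; last first.
      by rewrite sign_z // -ltnS ltn_neqAle ne.
    by rewrite -oppr_gt0 -mulNr -mulN1r -exprS P_b.
  have lt_lohi : lo i < hi i.
    rewrite /hi /lo; case: eqP => [->|/eqP ne].
      by have [/andP[]] := z_root n (leqnn _).
    case: i le_in ne {lo_sign hi_sign} => [|i] le_in ne.
      by have [/andP[]] := z_root 0 isT.
    by apply: z_incr; rewrite leqnn ltn_neqAle ne.
  have [|y yP] := ivt_neg (p := P n.+2) lt_lohi; last by exists y.
  have : (-1) ^+ i * (-1) ^+ i = 1 :> R by rewrite -expr2 sqrr_sign.
  by move: ((-1) ^+ i) lo_sign hi_sign => s; nra.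
have [y yP] := choice ylohi.
have yz i : (i <= n)%N -> y i < z i < y i.+1.
  move=> le_in; have [/andP[_ + ] _] := yP i (leqW le_in).
  rewrite /hi ltn_eqF // => ->; have [/andP[]] := yP i.+1 le_in.
  by rewrite /lo.
exists z, y; split=> //; split=> [i le_in|i j /andP[ltij ltjn]].
  have [/andP[loy yhi] rooty] := yP i le_in; split=> //; apply/andP; split.
    apply: le_lt_trans loy; case: i {yhi rooty} le_in => //= i lt_in.
    by have [/andP[/ltW]] := z_root i lt_in.
  apply: lt_le_trans yhi _; rewrite /hi; case: eqP => // /eqP ne.
  have [|/andP[_ /ltW] //] := z_root i.
  by rewrite ltn_neqAle ne.
have /andP[lty _] := yz i (leq_trans ltij ltjn).
case: j ltij ltjn => // j ltij ltjn.
have /andP[_ ltz] := yz j ltjn.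
by apply: lt_trans lty (le_lt_trans _ ltz); apply: z_le; rewrite -ltnS ltij.
Qed.

Lemma sturm_of_alternation : sturm_sequence a b P.
Proof.
split=> n.
- have [w [_ [wP _ _]]] := interlacing_zeros n.
  by have [] := zeros_between_prod wP (P_neq0 n) (size_P n).
- have [w [_ [wP _ _]]] := interlacing_zeros n.
  have w_uniq := zeros_between_uniq wP.
  exists (mkseq w n); split; rewrite ?size_mkseq // => x.
  (* The factorization has distinct linear factors, so every multiplicity is [0] or [1]. *)
  have mupE : mup x (P n) = (x \in mkseq w n).
    have [_ ->] := zeros_between_prod wP (P_neq0 n) (size_P n).
    rewrite -(big_map w xpredT (fun c => 'X - c%:P)) -mul_polyC.
    rewrite mupMr ?rootC ?lead_coef_eq0 // mu_prod_XsubC.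
    by rewrite /index_iota subn0 count_uniq_mem.
  rewrite mupE; split=> [xw|[_]]; last by case: (x \in _).
  rewrite xw; split=> //; move: xw => /mapP[i + ->].
  by rewrite mem_iota => ltin; have [/(_ i ltin)[]] := wP.
move=> n_gt0 x y [ltxy rx ry xy_consec].
have [w [z [wP zP wz]]] := interlacing_zeros n.
have [i ltin xE] := zeros_between_root zP (P_neq0 n.+1) (size_P n.+1) rx.
have [j ltjn yE] := zeros_between_root zP (P_neq0 n.+1) (size_P n.+1) ry.
have [z_root z_incr] := zP; have [w_root w_incr] := wP.
have z_le k l : (k <= l <= n)%N -> z k <= z l.
  case: (ltngtP k l) => // [ltkl|->] ltln; last exact: lexx.
  by apply/ltW/z_incr; rewrite ltkl.
have ltij : (i < j)%N.
  rewrite ltnNge; apply/negP => leji.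
  by move: ltxy; rewrite xE yE ltNge z_le ?leji.
(* Otherwise [z i.+1] would be a zero strictly between the two consecutive ones. *)
have jE : j = i.+1.
  apply/eqP; rewrite eqn_leq ltij andbT leqNgt; apply/negP => lt_ij.
  have [|_] := z_root i.+1; first exact: ltn_trans ltjn.
  apply/negP/xy_consec; rewrite xE yE !z_incr ?leqnn ?lt_ij //=.
  exact: leq_trans ltjn.
subst j x y; have lt_in : (i < n)%N by [].
exists (w i); split=> [|t [/andP[ltzt lttz] rt]].
  by split; [apply: wz | have [] := w_root i lt_in].
have [k ltkn tE] := zeros_between_root wP (P_neq0 n) (size_P n) rt.
subst t; have /andP[ltzw ltwz] := wz k ltkn.
(* If [k < i] then [w k < z k.+1 <= z i]; if [i < k] then [z i.+1 <= z k < w k]. Both put [w k]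
   outside the gap. *)
congr w; apply/eqP; rewrite eqn_leq.
apply/andP; split; rewrite leqNgt; apply/negP => lt.
  have := lt_trans ltzt ltwz; rewrite ltNge z_le //.
  by rewrite lt ltnW.
have := lt_trans ltzw lttz; rewrite ltNge z_le //.
by rewrite lt ltnW.
Qed.

End SturmFromAlternation.

(** * The Sturm property of the Hankel determinants *)

Theorem theorem4 (R : realType) : sturm_sequence (-2 : R) (2 : R) (@H0 R).
Proof.
apply: sturm_of_alternation.
- by lra.
- exact: size_H0_leq.
- exact: H0_N2.
- exact: H0_2.
by move=> n z /andP[z_gtN2 _]; apply: H0_neighbours.
Qed.
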